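(* Let $\Delta,m,k,t$ be positive integers and let $\mathcal{G}=\{G_1,\ldots,G_t\}$ be a family of graphs on the same vertex set $V(\mathcal{G})$. Suppose that (1) $|\Gamma_{\mathcal{G}}(X)| \geq \Delta |X| + 1$ for all $X \subseteq V(\mathcal{G})\times [t]$ with $1 \leq |X| \leq m$, and (2) $|\Gamma_{\mathcal{G}}(X)| \geq \Delta|X| + k$ for all $X \subseteq V(\mathcal{G})\times [t]$ with $m < |X| \leq 2m$. Then $\mathcal{G}$ contains every $[t]$-colored tree $\mathcal{T}$ with at most $k$ vertices and maximum $r$-degree $\Delta_r(\mathcal{T}) \leq \Delta$ for each $r \in [t]$.
   Context: Graphs are finite and simple, with non-empty vertex set. $[t]=\{1,\ldots,t\}$. For a graph $G$ and vertex $v$, $\Gamma_G(v)$ is the set of neighbors of $v$ in $G$. For $X\subseteq V(\mathcal{G})\times[t]$, $\Gamma_{\mathcal{G}}(X)=\bigcup_{(v,r)\in X}\Gamma_{G_r}(v)$. The graphs $G_i$ need not be edge-disjoint. A $[t]$-colored tree $\mathcal{T}$ is a tree $T$ with a map $f:E(T)\to[t]$ (an arbitrary, not necessarily proper, edge-coloring); the $r$-degree of a vertex $v$ is the number of neighbors $u$ of $v$ in $T$ with $f(uv)=r$, and $\Delta_r(\mathcal{T})$ is the maximum $r$-degree over all vertices. $\mathcal{G}$ contains $\mathcal{T}$ if there is an injective map $\phi:V(T)\to V(\mathcal{G})$ such that $\phi(u)\phi(v)\in E(G_{f(uv)})$ for every edge $uv\in E(T)$. *)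

(* Defs.v *)
(* MathComp *)
From mathcomp Require Import all_boot.

Set Implicit Arguments.
Unset Strict Implicit.
Unset Printing Implicit Defensive.

Record sgraph (V : finType) := SGraph {
  adj :> rel V;
  adj_sym : symmetric adj;
  adj_irrefl : irreflexive adj;
  vertices_nonempty : 0 < #|V|
}.

Definition neighbors (V : finType) (G : sgraph V) (v : V) : {set V} :=
  [set u | G v u].

Definition edge_set (V : finType) (G : sgraph V) : {set {set V}} :=
  [set [set u; v] | u in V, v in neighbors G u].

Definition edge (V : finType) (G : sgraph V) : finType :=
  {e : {set V} | e \in edge_set G}.

Lemma edge_subproof (V : finType) (G : sgraph V) (u v : V) :
  G u v -> [set u; v] \in edge_set G.
Proof. by move=> uv; apply/imset2P; exists u v; rewrite ?inE. Qed.

Definition mk_edge (V : finType) (G : sgraph V) (u v : V) (uv : G u v) :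
  edge G := exist _ [set u; v] (edge_subproof uv).

Definition connected (V : finType) (G : sgraph V) : Prop :=
  forall u v : V, connect G u v.

(* A sequence of length 1 or 2 may satisfy [ucycle] without being a graph
   cycle: [:: u; v] does so for every edge uv. *)
Definition acyclic (V : finType) (G : sgraph V) : Prop :=
  forall c : seq V, 2 < size c -> ~ ucycle G c.

Definition is_tree (V : finType) (G : sgraph V) : Prop :=
  connected G /\ acyclic G.

(* The colors 1, ..., t are represented by the elements of ['I_t]. *)
Record colored_tree (t : nat) (W : finType) := ColoredTree {
  tree_graph :> sgraph W;
  tree_graphP : is_tree tree_graph;
  color : edge tree_graph -> 'I_t
}.

Definition rdegree (t : nat) (W : finType) (T : colored_tree t W)
    (r : 'I_t) (v : W) : nat :=
  #|[set u : W | [exists e : edge T,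
       (val e == [set u; v]) && (color e == r)]]|.

Definition max_rdegree (t : nat) (W : finType) (T : colored_tree t W)
    (r : 'I_t) : nat :=
  \max_(v : W) rdegree T r v.

Definition family_neighbors (t : nat) (V : finType) (G : 'I_t -> sgraph V)
    (X : {set V * 'I_t}) : {set V} :=
  \bigcup_(p in X) neighbors (G p.2) p.1.

Definition contains (t : nat) (V W : finType) (G : 'I_t -> sgraph V)
    (T : colored_tree t W) : Prop :=
  exists phi : W -> V,
    injective phi /\
    forall (u v : W) (uv : T u v), G (color (mk_edge uv)) (phi u) (phi v).

(* Main.v *)
Require Import Defs.
From mathcomp Require Import all_boot.
From mathcomp Require Import zify.

Set Implicit Arguments.
Unset Strict Implicit.
Unset Printing Implicit Defensive.

(** The tree is embedded greedily, one leaf at a time, in the manner of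
Friedman and Pippenger.  The difficulty is to choose the image of each new
leaf so that the process never gets stuck.  To this end every pair
[(v, r)] of a host vertex and a color carries a demand [B (v, r)]: the number
of unused [r]-neighbors that [v] must still be able to supply.  It is [Delta]
for an unused [v], and for a used [v] it drops by one whenever an [r]-colored
leaf is attached at [v].  The invariant [meets_demand A B] is a Hall-type
condition: every set [X] of at most [m] pairs has at least as many
neighbors outside the set [A] of used vertices as its total demand.

For a single used vertex and the constant demand [Delta], the invariant is the
expansion hypothesis for small sets; the one used vertex accounts for the
[+ 1].  Suppose now that an [r]-neighbor of [a] is wanted, with
[0 < B (a, r)].  Using up [y] lowers by one the number of free neighbors of
each [X] whose neighborhood contains [y], and lowers the demand of [X] by one
when [X] contains [(a, r)].  So only the critical sets [X], those that meet
their demand with equality, can break the invariant, and only when they avoid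
[(a, r)].  The number of free neighbors is submodular and the demand is modular,
so the union of two critical sets has no neighbor to spare; as
the expansion hypothesis for large sets gives strict slack above size [m],
the union still has size at most [m] and is critical
([critical_setU]).  Let [M] be the union of all critical sets that avoid
[(a, r)].  If all free [r]-neighbors of [a] were neighbors of [M], then adding
[(a, r)] to [M] would raise the demand and add no free neighbor, against the
invariant or the slack.  Hence some free [r]-neighbor [y] of [a] lies outside
the neighborhood of [M], and this [y] is a safe choice
([meets_demand_extension]).

On the side of the tree, a connected proper subset of the vertices always
has a vertex outside it adjacent to it, by connectedness, and this vertex has
exactly one neighbor inside, by acyclicity ([attachment_unique]).  The new
vertex thus imposes a single adjacency condition, and iterating reaches the
whole tree. *)

(** * Expansion with demands *)

Section Demands.

Variables (V : finType) (t : nat) (G : 'I_t -> sgraph V) (m : nat).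
Implicit Types (A : {set V}) (B : V * 'I_t -> nat) (X Y : {set V * 'I_t}).

Local Notation N := (family_neighbors G).

Definition meets_demand A B :=
  forall X, #|X| <= m -> \sum_(p in X) B p <= #|N X :\: A|.

(** For [A] and [B] with [meets_demand A B] the inequality below is an equality:
these are the sets with no neighbor to spare. *)
Definition critical A B X :=
  (#|X| <= m) && (#|N X :\: A| <= \sum_(p in X) B p).

(** Sets of size up to [2 * m] matter because they arise as unions of two
critical sets, or as a critical set with one more pair. *)
Definition slack_above A B :=
  forall X, m < #|X| <= 2 * m -> \sum_(p in X) B p < #|N X :\: A|.

Lemma family_neighborsU X Y : N (X :|: Y) = N X :|: N Y.
Proof. exact: bigcup_setU. Qed.

Lemma family_neighborsS X Y : X \subset Y -> N X \subset N Y.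
Proof. by move/setUidPr <-; rewrite family_neighborsU subsetUl. Qed.

Lemma family_neighbors0 : N set0 = set0.
Proof. exact: big_set0. Qed.

Lemma family_neighbors1 a r : N [set (a, r)] = neighbors (G r) a.
Proof. exact: big_set1. Qed.

Lemma submodular_neighbors A X Y :
  #|N (X :|: Y) :\: A| + #|N (X :&: Y) :\: A|
    <= #|N X :\: A| + #|N Y :\: A|.
Proof.
rewrite family_neighborsU setDUl -[leqRHS]cardsUI leq_add2l -setDIl.
by rewrite subset_leq_card // setSD // subsetI !family_neighborsS //
  (subsetIl, subsetIr).
Qed.

Lemma sum_setUI B X Y :
  \sum_(p in X :|: Y) B p + \sum_(p in X :&: Y) B p
    = \sum_(p in X) B p + \sum_(p in Y) B p.
Proof.
have sum_mem Z : \sum_(p in Z) B p = \sum_p (p \in Z) * B p.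
  by rewrite big_mkcond; apply: eq_bigr => p _; case: (p \in Z); rewrite ?mul1n.
rewrite !sum_mem -!big_split; apply: eq_bigr => p _ /=; rewrite !inE.
by case: (p \in X); case: (p \in Y); lia.
Qed.

Lemma critical0 A B : critical A B set0.
Proof. by rewrite /critical cards0 family_neighbors0 set0D cards0. Qed.

(** By submodularity, the union has no more free neighbors than its demand
because the intersection has no fewer.  This is incompatible with the slack
of sets larger than [m], which bounds the size of the union. *)
Lemma critical_setU A B X Y : meets_demand A B -> slack_above A B ->
  critical A B X -> critical A B Y -> critical A B (X :|: Y).
Proof.
move=> meetAB slackAB /andP[leXm critX] /andP[leYm critY].
have leIm : #|X :&: Y| <= m.
  exact: leq_trans (subset_leq_card (subsetIl X Y)) leXm.
have critU : #|N (X :|: Y) :\: A| <= \sum_(p in X :|: Y) B p.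
  have := submodular_neighbors A X Y.
  by have := sum_setUI B X Y; have := meetAB _ leIm; lia.
rewrite /critical critU andbT leqNgt; apply/negP=> ltmU.
have leU2m : #|X :|: Y| <= 2 * m by have := cardsUI X Y; lia.
by have := slackAB (X :|: Y); rewrite ltmU leU2m ltnNge critU => /(_ isT).
Qed.

(** The new vertex is a free [r]-neighbor of [a] outside the neighborhood of the
largest critical set that avoids [(a, r)]; such a vertex exists since otherwise
that set together with [(a, r)] could not meet its demand. *)
Lemma meets_demand_extension A B a r :
    0 < m -> meets_demand A B -> slack_above A B -> 0 < B (a, r) ->
  exists y, [/\ G r a y, y \notin A
    & meets_demand (y |: A) (fun q => B q - (q == (a, r)))].
Proof.
move=> m_gt0 meetAB slackAB Bar_gt0.
pose M := \bigcup_(X | critical A B X && ((a, r) \notin X)) X.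
have /andP[critM arM] : critical A B M && ((a, r) \notin M).
  apply: (big_ind (fun X => critical A B X && ((a, r) \notin X))) => //.
    by rewrite critical0 inE.
  move=> X Y /andP[critX arX] /andP[critY arY].
  by rewrite critical_setU // inE negb_or arX.
have [|all_hit] := boolP [exists y, [&& G r a y, y \notin A & y \notin N M]].
  case/existsP=> y /and3P[ay yA yM]; exists y; split=> // X leXm /=.
  have leB : \sum_(q in X) (B q - (q == (a, r))) <= \sum_(q in X) B q.
    by apply: leq_sum => q _; rewrite leq_subr.
  have cardX : #|N X :\: A| = (y \in N X) + #|N X :\: (y |: A)|.
    by rewrite (cardsD1 y) inE yA setDDl setUC.
  have := meetAB X leXm; rewrite cardX.
  (* Losing y is harmless if y is not a neighbor of X, or if the demand of X
     drops too, or if X has a neighbor to spare.  The remaining sets are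
     contained in M. *)
  have [yX|_] := boolP (y \in N X); last exact: leq_trans leB.
  have [arX leB1|arX _] := boolP ((a, r) \in X).
    rewrite -ltnS; apply: leq_trans leB1.
    rewrite (bigD1 (a, r)) // [ltnRHS](bigD1 (a, r)) //= eqxx.
    rewrite -addSn leq_add //; first by lia.
    by apply: leq_sum => q _; rewrite leq_subr.
  have : ~~ critical A B X.
    apply: contra yM => critX; apply: subsetP yX.
    by apply: family_neighborsS; apply: bigcup_sup; rewrite critX.
  rewrite /critical leXm /= cardX yX -ltnNge.
  exact: leq_ltn_trans leB.
(* M' has the free neighbors of M but a larger demand.  Its size is at most
   m + 1 <= 2 * m, so one of the two hypotheses applies to it. *)
pose M' := (a, r) |: M.
have NM' : N M' :\: A = N M :\: A.
  rewrite family_neighborsU family_neighbors1 setDUl.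
  apply/setUidPr/subsetP=> y; rewrite !inE => /andP[yA ay]; rewrite yA /=.
  by move: all_hit => /existsPn/(_ y); rewrite ay yA /= negbK.
have cardM' : #|M'| = #|M|.+1 by rewrite cardsU1 arM.
have sumM' : \sum_(q in M') B q = B (a, r) + \sum_(q in M) B q.
  by rewrite big_setU1.
case/andP: critM => leMm leNM.
have : #|N M' :\: A| < \sum_(q in M') B q.
  by rewrite NM' sumM' -add1n leq_add.
rewrite ltnNge => /negP[]; case: (leqP #|M'| m) => [/meetAB //|ltmM'].
by apply/ltnW/slackAB; rewrite ltmM' cardM'; lia.
Qed.

(** Each pair demands at most [Delta], and fewer than [k] neighbors are lost. *)
Lemma slack_of_expansion k Delta A B :
    (forall X, m < #|X| <= 2 * m -> #|N X| >= Delta * #|X| + k) ->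
    #|A| < k -> (forall p, B p <= Delta) ->
  slack_above A B.
Proof.
move=> expand ltAk leB X /expand leNX.
have leBX : \sum_(p in X) B p <= Delta * #|X|.
  by rewrite mulnC -sum_nat_const; apply: leq_sum => p _.
have := cardsD (N X) A; have := subset_leq_card (subsetIr (N X) A).
by lia.
Qed.

End Demands.

(** * Growing a subtree one leaf at a time *)

Section Growth.

Variables (W : finType) (T : sgraph W).
Implicit Types S : {set W}.

(** Connectedness of the subgraph induced by [S], phrased on the vertex type of
[T] to avoid transporting paths from a subtype. *)
Definition connected_in S :=
  {in S &, forall u v, connect [rel x y in S | T x y] u v}.

Lemma connected_in1 w : connected_in [set w].
Proof. by move=> u v /set1P-> /set1P->. Qed.

Lemma connected_in_add S u w :
  connected_in S -> u \in S -> T u w -> connected_in (w |: S).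
Proof.
move=> connS uS uw.
set e := [rel x y in w |: S | T x y].
have e_sym : connect_sym e.
  by apply: sym_connect_sym => x y /=; rewrite adj_sym [_ && (y \in _)]andbC.
have to_u x : x \in w |: S -> connect e x u.
  case/setU1P=> [->|xS]; first by rewrite connect1 //= !inE eqxx uS orbT adj_sym.
  apply: connect_sub (connS x u xS uS) => y z /andP[/andP[yS zS] yz].
  by rewrite connect1 //= !inE yS zS !orbT.
move=> x y /to_u xu /to_u yu; apply: connect_trans xu _.
by rewrite e_sym.
Qed.

(** A path from [u0] to a vertex outside [S] has a first step leaving [S]. *)
Lemma boundary_edge S u0 : connected T -> u0 \in S -> S != setT ->
  exists u w, [/\ u \in S, w \notin S & T u w].
Proof.
move=> connT u0S; rewrite -subTset => /subsetPn[w _ wS].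
have [p] := connectP (connT u0 w).
elim: p u0 u0S => [|x p IHp] u uS /=; first by move=> _ wu; rewrite wu uS in wS.
case/andP=> ux xp lastp; have [xS|xS] := boolP (x \in S).
  exact: IHp xS xp lastp.
by exists u, x.
Qed.

(** Two distinct neighbors of [w] in [S], joined by a simple path inside [S],
would close up through [w] to a cycle. *)
Lemma attachment_unique S u v w : acyclic T -> connected_in S ->
  u \in S -> v \in S -> w \notin S -> T u w -> T v w -> u = v.
Proof.
move=> acycT connS uS vS wS uw vw; apply/eqP/negP=> /negP neq_uv.
have [p0 up0 lastp0] := connectP (connS u v uS vS).
case: (shortenP up0) lastp0 => p up Uup _ lastp.
have pS : {subset p <= S}.
  elim: p u {uS uw neq_uv up0 Uup lastp} up => //= x p IHp u.
  case/andP=> /andP[/andP[_ xS] _] /IHp pS y.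
  by rewrite inE => /predU1P[->|/pS].
apply: (acycT [:: w, u & p]).
  case: p {up Uup pS} lastp => //= vu; by rewrite vu eqxx in neq_uv.
rewrite /ucycle /= -/(uniq (u :: p)) Uup andbT rcons_path -lastp.
rewrite (adj_sym T w) uw vw andbT.
apply/andP; split; last first.
  rewrite inE negb_or; apply/andP; split; last by apply: contra wS => /pS.
  by apply: contraNneq wS => ->.
by apply: sub_path up => x y /andP[].
Qed.

End Growth.

(** * Embedding colored trees *)

Section Embedding.

Variables (t : nat) (W : finType) (T : colored_tree t W).

(** The adjacency counted by [rdegree].  Unlike [color (mk_edge uv)], it can be
used without a proof of adjacency at hand. *)
Definition color_adj (r : 'I_t) : rel W := fun v u =>
  [exists e : edge T, (val e == [set u; v]) && (color e == r)].

Lemma color_adj_sym r : symmetric (color_adj r).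
Proof. by move=> u v; rewrite /color_adj setUC. Qed.

Lemma color_adj_mk_edge u v (uv : T u v) : color_adj (color (mk_edge uv)) u v.
Proof. by apply/existsP; exists (mk_edge uv); rewrite /= setUC !eqxx. Qed.

Lemma color_adj_inj r s u v : color_adj r u v -> color_adj s u v -> r = s.
Proof.
case/existsP=> e /andP[/eqP eE /eqP <-] /existsP[e' /andP[/eqP e'E /eqP <-]].
by congr color; apply: val_inj; rewrite eE e'E.
Qed.

Lemma color_adj_adj r u v : color_adj r u v -> T u v.
Proof.
case/existsP=> -[e eP] /andP[/eqP /= eE _]; case/imset2P: eP => x y _.
rewrite inE eE => xy /setP uvE; have := uvE x; have := uvE y.
have := uvE u; have := uvE v; rewrite !inE !eqxx !orbT /=.
have neq_xy : x != y by apply: contraTneq xy => ->; rewrite adj_irrefl.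
move=> /esym/orP[]/eqP-> /esym/orP[]/eqP-> //; rewrite ?eqxx ?orbb ?orbT //.
- by move=> /eqP yx; rewrite yx eqxx in neq_xy.
- by rewrite adj_sym.
- by move=> _ /eqP yx; rewrite yx eqxx in neq_xy.
Qed.

Lemma max_rdegreeP r v : #|[set u | color_adj r v u]| <= max_rdegree T r.
Proof. exact: leq_bigmax. Qed.

Variables (Delta m k : nat) (V : finType) (G : 'I_t -> sgraph V).

(** The invariant of the greedy embedding; [S] is the part of the tree already
embedded.  Only an inequality is required in [pe_demand], since the demand at
the image of a new vertex is [Delta] whatever the degrees of that vertex. *)
Record partial_embedding (S : {set W}) (f : W -> V) (B : V * 'I_t -> nat) :
    Prop := PartialEmbedding {
  pe_connected : connected_in T S;
  pe_inj : {in S &, injective f};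
  pe_hom : forall r, {in S &, forall u v, color_adj r u v -> G r (f u) (f v)};
  pe_meets : meets_demand G m (f @: S) B;
  pe_bound : forall p, B p <= Delta;
  pe_free : forall v r, v \notin f @: S -> B (v, r) = Delta;
  pe_demand : forall u r, u \in S ->
    #|[set x in ~: S | color_adj r u x]| <= B (f u, r)
}.

Hypotheses (m_gt0 : 0 < m)
  (large_expansion : forall X : {set V * 'I_t}, m < #|X| <= 2 * m ->
     #|family_neighbors G X| >= Delta * #|X| + k)
  (small_degrees : forall r : 'I_t, max_rdegree T r <= Delta).

Lemma demand_le (S : {set W}) u r :
  #|[set x in ~: S | color_adj r u x]| <= Delta.
Proof.
apply: leq_trans (leq_trans (max_rdegreeP r u) (small_degrees r)).
by apply/subset_leq_card/subsetP=> x; rewrite !inE => /andP[].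
Qed.

(** The image [v] is the only vertex removed from the neighborhoods, and the
expansion of small sets leaves at least one neighbor to spare for it. *)
Lemma partial_embedding1 w v :
    (forall X : {set V * 'I_t}, 1 <= #|X| <= m ->
       #|family_neighbors G X| >= Delta * #|X| + 1) ->
  partial_embedding [set w] (fun=> v) (fun=> Delta).
Proof.
move=> small_expansion; split=> //.
- exact: connected_in1.
- by move=> x y /set1P-> /set1P->.
- move=> r x y /set1P-> /set1P-> /color_adj_adj.
  by rewrite adj_irrefl.
- move=> X leXm; rewrite sum_nat_const imset_set1 mulnC.
  have [->|X_gt0] := posnP #|X|; first by rewrite muln0.
  have := small_expansion X; rewrite leXm X_gt0 => /(_ isT).
  by rewrite (cardsD1 v); case: (v \in _); lia.
- by move=> u r _; apply: demand_le.
Qed.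

(** The demand at the image of the parent [u] is positive because [w] is still
to be embedded.  Lowering it by one pays for [w], which then leaves the set
counted by [pe_demand]; the image of [w] was unused, so its demand [Delta]
covers all neighbors of [w]. *)
Lemma partial_embedding_step (S : {set W}) f B u0 :
    #|S| < k -> u0 \in S -> S != setT -> partial_embedding S f B ->
  exists (S' : {set W}) f' B', #|S'| = #|S|.+1 /\ partial_embedding S' f' B'.
Proof.
move=> ltSk u0S ST [connS injf homf meetB leB freeB demB].
have [connT acycT] := tree_graphP T.
have [u [w [uS wS uw]]] := boundary_edge connT u0S ST.
have uniq_u v : v \in S -> T v w -> v = u.
  by move=> vS vw; apply: attachment_unique acycT connS vS uS wS vw uw.
pose r := color (mk_edge uw).
have ruw : color_adj r u w by apply: color_adj_mk_edge.
have B_gt0 : 0 < B (f u, r).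
  apply: leq_trans (demB u r uS); apply/card_gt0P; exists w.
  by rewrite !inE wS.
have slackB : slack_above G m (f @: S) B.
  apply: slack_of_expansion large_expansion _ leB.
  exact: leq_ltn_trans (leq_imset_card f S) ltSk.
have [y [ay yS meetB']] := meets_demand_extension m_gt0 meetB slackB B_gt0.
pose f' x := if x == w then y else f x.
have f'w : f' w = y by rewrite /f' eqxx.
have f'S x : x \in S -> f' x = f x.
  by move=> xS; rewrite /f'; case: eqP xS wS => // -> ->.
have imf' : f' @: (w |: S) = y |: f @: S.
  by rewrite imsetU1 f'w; congr (_ |: _); apply: eq_in_imset.
have fyN x : x \in S -> f x != y.
  by move=> xS; apply: contraNneq yS => <-; apply: imset_f.
exists (w |: S), f', (fun q => B q - (q == (f u, r))); split.
  by rewrite cardsU1 wS.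
split.
- exact: connected_in_add connS uS uw.
- move=> x z /setU1P[->|xS] /setU1P[->|zS] //; rewrite ?f'w ?f'S //.
  + by move=> yz; have := fyN z zS; rewrite -yz eqxx.
  + by move=> yx; have := fyN x xS; rewrite yx eqxx.
  + exact: injf.
- have attach s x : x \in S -> color_adj s x w -> G s (f x) y.
    move=> xS xw; have xu := uniq_u x xS (color_adj_adj xw).
    by rewrite xu in xw *; rewrite (color_adj_inj xw ruw).
  move=> s x z /setU1P[->|xS] /setU1P[->|zS]; rewrite ?f'w ?f'S //.
  + by move/color_adj_adj; rewrite adj_irrefl.
  + by rewrite color_adj_sym adj_sym; apply: attach.
  + exact: attach.
  + exact: homf.
- by rewrite imf'.
- by move=> p; apply: leq_trans (leq_subr _ _) (leB p).
- move=> v s; rewrite imf' !inE negb_or => /andP[_ vS].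
  rewrite freeB // xpair_eqE; case: eqP vS => [->|_]; last by rewrite subn0.
  by rewrite imset_f.
- move=> x s /setU1P[->|xS].
    rewrite f'w freeB // xpair_eqE eq_sym (negPf (fyN u uS)) subn0.
    exact: demand_le.
  rewrite f'S // xpair_eqE; have := demB x s xS.
  have sub : [set z in ~: (w |: S) | color_adj s x z]
      = [set z in ~: S | color_adj s x z] :\ w.
    by apply/setP=> z; rewrite !inE negb_or andbA.
  rewrite sub (cardsD1 w [set z in ~: S | _]) !inE wS /=.
  case: eqP => [fxu|_]; last by lia.
  have -> : x = u by apply: injf.
  case: eqP => [->|_]; last by lia.
  by rewrite ruw; lia.
Qed.

End Embedding.

Theorem theorem6 (Delta m k t : nat)
  (Delta_gt0 : 0 < Delta) (m_gt0 : 0 < m) (k_gt0 : 0 < k) (t_gt0 : 0 < t)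
  (V : finType) (G : 'I_t -> sgraph V)
  (small_expansion : forall X : {set V * 'I_t}, 1 <= #|X| <= m ->
     #|family_neighbors G X| >= Delta * #|X| + 1)
  (large_expansion : forall X : {set V * 'I_t}, m < #|X| <= 2 * m ->
     #|family_neighbors G X| >= Delta * #|X| + k) :
  forall (W : finType) (T : colored_tree t W),
    #|W| <= k ->
    (forall r : 'I_t, max_rdegree T r <= Delta) ->
    contains G T.
Proof.
move=> W T leWk small_degrees.
have /card_gt0P[w0 _] := vertices_nonempty T.
have /card_gt0P[v0 _] := vertices_nonempty (G (Ordinal t_gt0)).
have grow n : n < #|W| -> exists (S : {set W}) f B,
    #|S| = n.+1 /\ partial_embedding T Delta m G S f B.
  elim: n => [_|n IHn ltnW].
    exists [set w0], (fun=> v0), (fun=> Delta); rewrite cards1; split=> //.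
    exact: partial_embedding1.
  have [S [f [B [cardS embS]]]] := IHn (ltn_trans (ltnSn n) ltnW).
  have /card_gt0P[u0 u0S] : 0 < #|S| by rewrite cardS.
  have ST : S != setT.
    by apply: contraTneq ltnW => ST; rewrite -cardS ST cardsT ltnn.
  have ltSk : #|S| < k by rewrite cardS; apply: leq_trans ltnW leWk.
  rewrite -cardS.
  exact: (partial_embedding_step m_gt0 large_expansion small_degrees
    ltSk u0S ST embS).
have W_gt0 : 0 < #|W| := vertices_nonempty T.
have [S [f [B [cardS [_ injf homf _ _ _ _]]]]] : exists (S : {set W}) f B,
    #|S| = #|W| /\ partial_embedding T Delta m G S f B.
  by have := grow #|W|.-1; rewrite prednK //; apply.
have ST : S = setT by apply/eqP; rewrite eqEcard subsetT cardsT cardS leqnn.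
exists f; split=> [x y|u v uv]; first by apply: injf; rewrite ST inE.
by apply: homf (color_adj_mk_edge uv); rewrite ST inE.
Qed.
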